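(* Let $n\in\mathbb{N}$, $k\in\{0,6\}$ and $x=12n+k$. Put $n_1=n$, $b_1=2$, $b_2=10$ if $k=0$, and $n_1=n+1$, $b_1=4$, $b_2=8$ if $k=6$. Then the degree of $x$ in the near Goldbach graph $G(x/2)$ is $n+n_1-f(n)$, where $$f(n)=\left|\bigcup_{\substack{p\text{ prime}\\ 3<p<\sqrt{x}}}\left(F(x,p,+)\cup F(x,p,-)\right)\right|,$$ and, for every prime $p$ with $3<p<\sqrt{x}$, $|F(x,p,+)\cup F(x,p,-)|$ equals $$\begin{cases}\lfloor (n_1-k_1)/p\rfloor+\lfloor (n-k_3)/p\rfloor+2, & p\mid x,\\ \lfloor (n_1-k_1)/p\rfloor+\lfloor (n_1-k_2)/p\rfloor+\lfloor (n-k_3)/p\rfloor+\lfloor (n-k_4)/p\rfloor+3, & p\nmid x,\end{cases}$$ with $k_1=[(p-[x]_p^1-b_1)\cdot 12^{p-2}]_p+1$, $k_2=[(x-b_1)\cdot 12^{p-2}]_p+1$, $k_3=[(p-[x]_p^1-b_2)\cdot 12^{p-2}]_p+1$, $k_4=[(x-b_2)\cdot 12^{p-2}]_p+1$.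
   Context: $\mathbb{N}$ denotes the positive integers. For $N\in\mathbb{N}$, the near Goldbach graph $G(N)$ is the simple undirected graph with vertex set $\{2,4,\ldots,2N\}$ in which two distinct vertices $a,b$ are adjacent iff both $\frac{a+b}{2}$ and $\frac{|a-b|}{2}$ lie in $\{q: q\text{ prime},\ 2<q<2N\}\cup\{1\}$. For an integer $a$, $[a]_p$ is the element of $\{0,1,\ldots,p-1\}$ congruent to $a$ modulo $p$, and $[a]_p^1$ is the element of $\{1,2,\ldots,p\}$ congruent to $a$ modulo $p$. For $x=12n+k$ let $S=\{12m+2:0\le m\le n-1\}\cup\{12m+10: 0\le m\le n-1\}$ if $k=0$, and $S=\{12m+4: 0\le m\le n\}\cup\{12m+8: 0\le m\le n-1\}$ if $k=6$ ($m$ an integer). For a prime $p$ with $3<p<\sqrt{x}$, $F(x,p,+)=\{y\in S: p\mid x+y\}$ and $F(x,p,-)=\{y\in S: p\mid x-y,\ x-y\neq 2p\}$. *)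

(* Defs.v *)
From mathcomp Require Import all_boot all_order all_algebra all_field.
From mathcomp Require Import finmap.
Set Implicit Arguments.
Unset Strict Implicit.
Unset Printing Implicit Defensive.
Import Order.TTheory GRing.Theory Num.Theory.
Local Open Scope ring_scope.

Record sgraph := SGraph {
  vert : {fset nat};
  adj : rel nat;
  adj_vert : forall a b, adj a b -> (a \in vert) && (b \in vert);
  adj_sym : symmetric adj;
  adj_irr : irreflexive adj }.

Definition degree (G : sgraph) (a : nat) : nat :=
  #|` [fset b in vert G | adj G a b]%fset |.

Definition ngg_vert (N : nat) : {fset nat} := [fset (2 * i)%N | i in iota 1 N]%fset.

Definition ngg_val (N : nat) : pred nat :=
  fun q => (prime q && (2 < q < 2 * N)%N) || (q == 1)%N.

(* The vertices are even, so both halves are exact. `|a - b|%N is the distance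
   between the naturals a and b, not a truncated difference. *)
Definition ngg_adj (N : nat) : rel nat := fun a b =>
  [&& a \in ngg_vert N, b \in ngg_vert N, a != b,
      ngg_val N ((a + b) %/ 2)%N & ngg_val N (`|a - b| %/ 2)%N].

Lemma ngg_adj_vert N a b :
  ngg_adj N a b -> (a \in ngg_vert N) && (b \in ngg_vert N).
Proof. by case/and5P=> -> ->. Qed.

Lemma ngg_adj_sym N : symmetric (ngg_adj N).
Proof.
by move=> a b; rewrite /ngg_adj andbCA eq_sym addnC distnC.
Qed.

Lemma ngg_adj_irr N : irreflexive (ngg_adj N).
Proof. by move=> a; rewrite /ngg_adj eqxx !andbF. Qed.

Definition near_goldbach (N : nat) : sgraph :=
  SGraph (@ngg_adj_vert N) (@ngg_adj_sym N) (@ngg_adj_irr N).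

(* For p > 0, intdiv's %% and %/ are the least nonnegative residue and the
   floor of the quotient, also for negative dividends. *)
Definition res0 (p : nat) (a : int) : int := (a %% p%:Z)%Z.
Definition res1 (p : nat) (a : int) : int := ((a - 1) %% p%:Z)%Z + 1.

(* Only k = 0 and k = 6 are meaningful; the second branch is the case k = 6. *)
Definition Sset (n k : nat) : {fset nat} :=
  if k == 0%N then
    ([fset (12 * m + 2)%N | m in iota 0 n]
       `|` [fset (12 * m + 10)%N | m in iota 0 n])%fset
  else
    ([fset (12 * m + 4)%N | m in iota 0 n.+1]
       `|` [fset (12 * m + 8)%N | m in iota 0 n])%fset.

Definition Fplus (n k p : nat) : {fset nat} :=
  let x := (12 * n + k)%N in
  [fset y in Sset n k | (p %| x + y)%N]%fset.

Definition Fminus (n k p : nat) : {fset nat} :=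
  let x := (12 * n + k)%N in
  [fset y in Sset n k | (p%:Z %| x%:Z - y%:Z)%Z && (x%:Z - y%:Z != (2 * p)%:Z)%R]%fset.

Definition sieve_prime (x p : nat) : bool :=
  [&& prime p, (3 < p)%N & p%:R < sqrtC (x%:R : algC)].

(* The bound p < x loses nothing, since p < sqrt x forces p < x. *)
Definition sieve_count (n k : nat) : nat :=
  let x := (12 * n + k)%N in
  #|` (\bigcup_(p <- iota 0 x | sieve_prime x p)
         (Fplus n k p `|` Fminus n k p))%fset |.

(* Main.v *)
Require Import Defs.
From mathcomp Require Import all_boot all_order all_algebra all_field.
From mathcomp Require Import cyclic finmap.
From mathcomp Require Import zify ring.
Set Implicit Arguments.
Unset Strict Implicit.
Unset Printing Implicit Defensive.
Import Order.TTheory GRing.Theory Num.Theory.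
Local Open Scope ring_scope.

(** Write [x = 12 n + k], a multiple of 6 that is at least 12. A vertex [y] is
    adjacent to [x] when the half-sum [s = (x + y)/2] is prime and the
    half-difference [d = (x - y)/2] is prime or 1. Since 6 divides [x], this
    forces [s] and [d] to be prime to 6, which is a condition on [y] modulo 12;
    the numbers below [x] satisfying it are exactly those of [Sset n k]
    ([mem_Sset]). For [y] in that set, [s] and [d] are smaller than [x], so
    compositeness of either one is witnessed by a prime [p > 3] with
    [p * p < x] ([sieve_primality]). Such a [p] always divides [s] properly,
    because [s > x/2], and it divides [d] properly unless [x - y = 2 p]: this
    is the exception built into [Fminus]. Hence the neighbours of [x] are the
    elements of [Sset n k] outside the union of the sieving sets
    ([ngg_adj_sieve]), and the degree is a difference of cardinals.

    For the size of a single sieving set, [Fplus] is the class of [- x] modulo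
    [p] inside [Sset n k], and [Fminus] is the class of [x] with its element
    [x - 2 p] removed. The two classes coincide if [p] divides [x], and are
    disjoint otherwise since [p] is odd; in the first case the removed element
    still lies in [Fplus], in the second it lowers the total by one
    ([card_FplusUminus]). Each class meets the two progressions of difference
    12 that make up [Sset n k] in one residue class of the index [m] modulo
    [p], found by inverting 12 with Fermat's little theorem
    ([count_class]). *)

Lemma sieve_primeE (x p : nat) :
  sieve_prime x p = [&& prime p, (3 < p)%N & (p * p < x)%N].
Proof.
rewrite /sieve_prime; congr [&& _, _ & _].
rewrite -(ltr_pXn2r (n := 2)) ?nnegrE ?ler0n ?sqrtC_ge0 //.
by rewrite sqrtCK -natrX ltr_nat mulnn.
Qed.

Lemma card_fset_uniq (T : choiceType) (A : {fset T}) (s : seq T) :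
  uniq s -> A =i s -> #|` A |%fset = size s.
Proof. by move=> us As; apply/perm_size/uniq_perm; rewrite ?fset_uniq. Qed.

(** The two progressions have distinct residues modulo 12, so their lists can be
    concatenated without repetition; this turns every cardinal below into a
    count over initial segments of the naturals. *)
Lemma card_Sset_filter n k (P : pred nat) :
  #|` [fset y in Sset n k | P y] |%fset =
  (count P [seq (12 * m + (if k == 0 then 2 else 4))%N
           | m <- iota 0 (if k == 0 then n else n.+1)]
   + count P [seq (12 * m + (if k == 0 then 10 else 8))%N | m <- iota 0 n])%N.
Proof.
rewrite -count_cat -size_filter; apply: card_fset_uniq => [|y].
  apply: filter_uniq; rewrite cat_uniq !map_inj_uniq ?iota_uniq => [|u v|u v]; try lia.
  rewrite andbT; apply/hasPn => y /mapP[u _ ->]; apply/mapP => -[v _].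
  by case: ifP; lia.
rewrite mem_filter mem_cat !inE /= andbC; congr (_ && _).
by rewrite /Sset; case: ifP => _; rewrite in_fsetU; congr (_ || _);
   apply/imfsetP/mapP => -[m hm ->]; exists m.
Qed.

Lemma card_Sset n k :
  #|` Sset n k |%fset = (n + (if k == 0%N then n else n.+1))%N.
Proof.
have -> : Sset n k = [fset y in Sset n k | predT y]%fset.
  by apply/fsetP => y; rewrite !inE /= andbT.
by rewrite card_Sset_filter !count_predT !size_map !size_iota addnC.
Qed.

(** The quotient of [l + (p - r.+1)] by [p] jumps exactly when [l] passes
    a value congruent to [r], which is the induction step. *)
Lemma count_residue p r l : (r < p)%N ->
  count (fun m => m == r %[mod p])%N (iota 0 l) = ((l + (p - r.+1)) %/ p)%N.
Proof.
move=> rp; elim: l => [|l IH]; first by rewrite /= divn_small //; lia.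
rewrite -addn1 iotaD count_cat IH /= add0n !addn0 addn1 addSn divnS; last by lia.
rewrite addnC; congr (nat_of_bool _ + _)%N.
have -> : (l + (p - r.+1)).+1 = (l + p - r)%N by lia.
rewrite -(eqn_mod_dvd _ (m := (l + p)%N)); last by lia.
by rewrite modnDr.
Qed.

(** Fermat's little theorem: [12 ^+ (p - 2)] inverts 12 modulo [p]. *)
Lemma inv12_mod p : prime p -> (3 < p)%N -> (p%:Z %| 12 * 12 ^+ (p - 2) - 1)%Z.
Proof.
move=> pp p3; have cop : coprime 12 p.
  rewrite coprime_sym prime_coprime //; apply/negP.
  rewrite (_ : 12 = 2 * 2 * 3)%N // !Euclid_dvdM // => h.
  by move: h; rewrite orbb => /orP[] /dvdn_leq; lia.
have := Euler_exp_totient cop; rewrite totient_prime // => E.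
have -> : 12 * 12 ^+ (p - 2) = (12 ^ p.-1)%N%:Z :> int.
  have -> : p.-1 = (p - 2).+1 by lia.
  by rewrite -exprS -[RHS]natz natrX.
by rewrite -eqz_mod_dvd !modz_nat E.
Qed.

(** The index [m] is counted when [12 m] is congruent to [c - b], that is when
    [m] lies in the class of [a * 12 ^+ (p - 2)]. The representative [a] of
    [c - b] is left free because for [c = - x] the natural choice of
    representative is not [- x - b] itself. The quotient may be [-1], when the
    residue is not reached below [l]. *)
Lemma count_class p (c a : int) b l : prime p -> (3 < p)%N ->
  (a = c - b%:Z %[mod p%:Z])%Z ->
  (count (fun y : nat => p%:Z %| c - y%:Z)%Z [seq (12 * m + b)%N | m <- iota 0 l])%:Z
  = ((l%:Z - (res0 p (a * 12 ^+ (p - 2)) + 1)) %/ p%:Z)%Z + 1.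
Proof.
move=> pp p3 /eqP; rewrite eqz_mod_dvd => ha.
have hi := inv12_mod pp p3; set i : int := 12 ^+ (p - 2) in hi *.
have p0 : (p%:Z != 0) by lia.
have r0 := modz_ge0 (a * i) p0.
have rp := ltz_pmod (a * i) (_ : 0 < p%:Z); rewrite -/(res0 _ _) in r0 rp *.
have hr : (p%:Z %| res0 p (a * i) - a * i)%Z by rewrite -eqz_mod_dvd modz_mod.
move: (res0 p (a * i)) r0 rp hr => [r|//] _ rp hr.
have {}rp : (r < p)%N by apply: rp; lia.
rewrite count_map (@eq_count _ _ (fun m => m == r %[mod p])%N) => [|m /=].
  rewrite count_residue // -divz_nat.
  have -> : (l + (p - r.+1))%N%:Z = 1 * p%:Z + (l%:Z - (r%:Z + 1)) by lia.
  by rewrite divzMDl // addrC.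
rewrite -[RHS]eqz_nat -!modz_nat eqz_mod_dvd.
(* The two differences are divisible by p together: each one is the other
   multiplied by the unit i or 12, up to the known multiples of p. *)
have e1 : m%:Z - r%:Z = - m%:Z * (12 * i - 1) - i * (c - (12 * m + b)%N%:Z)
      - (r%:Z - a * i) - i * (a - (c - b%:Z)).
  by rewrite PoszD PoszM; ring.
have e2 : c - (12 * m + b)%N%:Z = - (c - b%:Z) * (12 * i - 1)
      - 12 * (m%:Z - r%:Z) - 12 * (r%:Z - a * i) - 12 * i * (a - (c - b%:Z)).
  by rewrite PoszD PoszM; ring.
by apply/idP/idP => h; [rewrite e1 | rewrite e2]; do ?[exact: hr | apply: rpredB]; exact: dvdz_mull.
Qed.

(** For [y] satisfying the right-hand side, [y] is even and both [(x + y)/2] and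
    [(x - y)/2] are prime to 6: the first is odd by the condition modulo 4, the
    second differs from it by the even number [y], and 3 divides [x] but not
    [y]. *)
Lemma mem_Sset n k (y : nat) : k = 0%N \/ k = 6%N ->
  (y \in Sset n k) =
  [&& (y < 12 * n + k)%N, ((12 * n + k + y) %% 4 == 2)%N & ~~ (3 %| y)%N].
Proof.
move=> hk; have mem_ap (b l : nat) :
    (y \in [fset (12 * m + b)%N | m in iota 0 l]%fset) =
    [&& (b <= y)%N, (12 %| y - b)%N & ((y - b) %/ 12 < l)%N].
  apply/imfsetP/and3P => [[m /=]|[h1 h2 h3]].
    by rewrite mem_iota => hm ->; split; lia.
  by exists ((y - b) %/ 12)%N => /=; [rewrite mem_iota | lia].
by case: hk => ->; rewrite /Sset [(_ == 0)%N]/= in_fsetU !mem_ap; lia.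
Qed.

Lemma mem_Fplus n k p (y : nat) : (y \in Fplus n k p) =
  (y \in Sset n k) && (p%:Z %| - (12 * n + k)%N%:Z - y%:Z)%Z.
Proof. by rewrite !inE /= -opprD -PoszD dvdzE abszN. Qed.

Lemma mem_Fminus n k p (y : nat) : (y \in Fminus n k p) =
  [&& y \in Sset n k, (p%:Z %| (12 * n + k)%N%:Z - y%:Z)%Z
    & (12 * n + k)%N != (y + 2 * p)%N].
Proof. by rewrite !inE /=; congr [&& _, _ & _]; lia. Qed.

(** The smallest prime factor of a composite [q < x] has its square at most [q],
    hence would be a sieving prime distinct from [q]. *)
Lemma sieve_primality x q : odd q -> ~~ (3 %| q)%N -> (1 < q < x)%N ->
  (forall p, sieve_prime x p -> (p %| q)%N -> p = q) -> prime q.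
Proof.
move=> oq q3 /andP[q1 qx] H; have pp := pdiv_prime q1; have pq := pdiv_dvd q.
have [h|h] := ltnP q (pdiv q ^ 2); first by apply: ltn_pdiv2_prime => //; lia.
suff <- : pdiv q = q by [].
apply: H => //; rewrite sieve_primeE pp mulnn (leq_ltn_trans h qx) andbT /=.
have := prime_gt1 pp; have n2 : (pdiv q <> 2)%N by move=> e; move: pq; rewrite e; lia.
have n3 : (pdiv q <> 3)%N by move=> e; move: q3; rewrite -e pq.
lia.
Qed.

Lemma res1_mod (p : nat) (x b : int) :
  (p%:Z - res1 p x - b = - x - b %[mod p%:Z])%Z.
Proof.
apply/eqP; rewrite eqz_mod_dvd /res1.
have -> : p%:Z - (((x - 1) %% p%:Z)%Z + 1) - b - (- x - b)
          = (1 + ((x - 1) %/ p%:Z)%Z) * p%:Z.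
  move: (divz_eq (x - 1) p%:Z); move: (_ %/ _)%Z (_ %% _)%Z => q r E.
  by rewrite -[x](subrK 1) E; ring.
exact: dvdz_mull.
Qed.

Lemma card_class n k p (a1 a2 c : int) : prime p -> (3 < p)%N ->
  let b1 : int := if k == 0%N then 2 else 4 in
  let b2 : int := if k == 0%N then 10 else 8 in
  let n1 := if k == 0%N then n else n.+1 in
  (a1 = c - b1 %[mod p%:Z])%Z -> (a2 = c - b2 %[mod p%:Z])%Z ->
  #|` [fset y in Sset n k | (p%:Z %| c - y%:Z)%Z] |%fset%:Z
  = ((n1%:Z - (res0 p (a1 * 12 ^+ (p - 2)) + 1)) %/ p%:Z)%Z
    + ((n%:Z - (res0 p (a2 * 12 ^+ (p - 2)) + 1)) %/ p%:Z)%Z + 2.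
Proof.
move=> pp p3 b1 b2 n1 h1 h2.
rewrite (card_Sset_filter _ _ (fun y : nat => p%:Z %| c - y%:Z)%Z) PoszD.
rewrite (@count_class _ _ a1) // 1?(@count_class _ _ a2) //.
- by rewrite -/n1; ring.
- by rewrite h2 /b2; case: ifP.
- by rewrite h1 /b1; case: ifP.
Qed.

Lemma prime_gt3_coprime6 p : prime p -> (3 < p)%N -> odd p && ~~ (3 %| p)%N.
Proof.
move=> pp p3; apply/andP; split; first by case: (even_prime pp) => // e; lia.
by rewrite (dvdn_prime2 (p := 3%N)) //; lia.
Qed.

Lemma dvdz_double p (z : int) : odd p -> (p%:Z %| 2 * z)%Z = (p%:Z %| z)%Z.
Proof. by move=> op; rewrite Gauss_dvdzr // coprimezE /= coprimen2. Qed.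

(** Since [p] is prime to 6, [2 p] is 2 or 10 modulo 12, and subtracting it from
    [x] lands in one of the two progressions. This element is the one
    excluded from [Fminus], and the origin of the constant 3 in place of 4. *)
Lemma sub_double_mem_Sset n k p : k = 0%N \/ k = 6%N -> sieve_prime (12 * n + k) p ->
  (12 * n + k - 2 * p)%N \in Sset n k /\ (2 * p <= 12 * n + k)%N.
Proof.
rewrite sieve_primeE => hk /and3P[pp p3 px]; have /andP[op t] := prime_gt3_coprime6 pp p3.
have h : (2 * p <= 12 * n + k)%N by nia.
split=> //; rewrite mem_Sset //; case: hk => e; subst k; lia.
Qed.

Lemma card_FplusUminus n k p : k = 0%N \/ k = 6%N -> sieve_prime (12 * n + k) p ->
  let x := (12 * n + k)%N in
  let cls (c : int) := #|` [fset y in Sset n k | (p%:Z %| c - y%:Z)%Z] |%fset in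
  #|` (Fplus n k p `|` Fminus n k p)%fset |%:Z =
  if (p %| x)%N then (cls (- x%:Z))%:Z else (cls (- x%:Z))%:Z + (cls x%:Z)%:Z - 1.
Proof.
move=> hk hp x cls; have [hr rle] := sub_double_mem_Sset hk hp.
move: (hp); rewrite sieve_primeE => /and3P[pp p3 px].
have /andP[op _] := prime_gt3_coprime6 pp p3.
have -> : cls (- x%:Z) = #|` Fplus n k p|%fset.
  by congr #|` _|%fset; apply/fsetP => y; rewrite mem_Fplus !inE.
case: ifP => px0.
  congr (Posz #|` _|%fset); apply/fsetUidPl/fsubsetP => y.
  rewrite mem_Fplus mem_Fminus => /and3P[-> /= h _].
  have -> : - (12 * n + k)%N%:Z - y%:Z = (x%:Z - y%:Z) - 2 * x%:Z by rewrite /x; ring.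
  by apply: rpredB => //; apply: dvdz_mull.
have -> : cls x%:Z = (#|` Fminus n k p|%fset).+1.
  rewrite /cls (cardfsD1 (x - 2 * p)%N) !inE hr /=.
  have -> : (p%:Z %| x%:Z - (x - 2 * p)%N%:Z)%Z.
    by rewrite (_ : _ - _ = 2 * p%:Z) ?dvdz_mull //; lia.
  rewrite add1n; congr (#|` _|%fset).+1; apply/fsetP => y.
  rewrite mem_Fminus !inE andbC -andbA; congr [&& _, _ & _].
  by rewrite -/x; lia.
rewrite cardfsU (_ : (_ `&` _)%fset = fset0) ?cardfs0; first by lia.
apply/fsetP => y; rewrite in_fsetI mem_Fplus mem_Fminus in_fset0.
apply/negP => /andP[/andP[_ h1] /and3P[_ h2 _]].
move/negP: px0; apply; rewrite -[(p %| x)%N]/(p%:Z %| x%:Z)%Z -dvdz_double //.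
rewrite (_ : 2 * _ = (x%:Z - y%:Z) - (- x%:Z - y%:Z)); last by ring.
exact: rpredB.
Qed.

(** A prime [s] or [d] that a sieving [p] divides must equal [p]. For
    [s = (x + y)/2] this contradicts [p * p < x <= 2 s]; for [d = (x - y)/2] it
    means [x - y = 2 p], which [Fminus] excludes. Conversely [sieve_primality]
    applies to [s] and to [d] when [d <> 1]. *)
Lemma ngg_adj_sieve n k (y : nat) : (0 < n)%N -> k = 0%N \/ k = 6%N ->
  let x := (12 * n + k)%N in
  ngg_adj (x %/ 2) x y =
  (y \in Sset n k) &&
  (y \notin \bigcup_(p <- iota 0 x | sieve_prime x p)
              (Fplus n k p `|` Fminus n k p))%fset.
Proof.
move=> hn hk x.
have x2 : (2 * (x %/ 2) = x)%N by rewrite /x; case: hk => ->; lia.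
have x12 : (12 <= x)%N by rewrite /x; lia.
have x3 : (3 %| x)%N by rewrite /x; case: hk => ->; lia.
have memV z : (z \in ngg_vert (x %/ 2)) = [&& (0 < z)%N, (z <= x)%N & ~~ odd z].
  apply/imfsetP/idP => [[i /=]|h]; first by rewrite mem_iota => hi ->; lia.
  by exists (z %/ 2)%N => /=; rewrite ?mem_iota; lia.
rewrite /ngg_adj !memV /ngg_val x2 mem_Sset // -/x.
apply/idP/idP.
- case/and5P => /and3P[_ _ ox] /and3P[y0 yx oy] nxy.
  have sE : (x + y = 2 * ((x + y) %/ 2))%N by lia.
  have dE : (x = y + 2 * (`|x - y| %/ 2))%N by lia.
  set s := ((x + y) %/ 2)%N in sE *; set d := (`|x - y| %/ 2)%N in dE *.
  move=> hs hd.
  have {hs} /andP[ps s2] : prime s && (2 < s < x)%N by case/orP: hs => //; lia.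
  have os : odd s by case: (even_prime ps) => // e; lia.
  have s3 : ~~ (3 %| s)%N by rewrite (dvdn_prime2 (p := 3%N)) //; lia.
  apply/andP; split; first by apply/and3P; split; lia.
  apply/bigfcupP => -[p /andP[_ hp]].
  move: (hp); rewrite sieve_primeE => /and3P[pp p3 px].
  have /andP[op _] := prime_gt3_coprime6 pp p3.
  rewrite in_fsetU mem_Fplus mem_Fminus -/x => /orP[/andP[_]|/and3P[_]].
    rewrite -opprD -PoszD dvdzE abszN sE /= Gauss_dvdr ?coprimen2 //.
    rewrite dvdn_prime2 // => /eqP e; nia.
  rewrite {1}dE (_ : _ - _ = 2 * d%:Z); last by lia.
  rewrite dvdz_double // dvdzE /= => pd /eqP ne.
  case/orP: hd => [/andP[pd' _]|/eqP d1].
    by move: pd; rewrite dvdn_prime2 // => /eqP e; lia.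
  by move: pd; rewrite d1 dvdn1; lia.
- case/andP => /and3P[yx m4 y3] nU.
  have noF p : sieve_prime x p -> (y \notin Fplus n k p) && (y \notin Fminus n k p).
    move=> hp; rewrite -negb_or -in_fsetU; apply: contra nU => h.
    apply/bigfcupP; exists p => //; rewrite hp andbT mem_iota.
    by move: hp; rewrite sieve_primeE; nia.
  have yS : y \in Sset n k by rewrite mem_Sset // -/x yx m4.
  have ox : ~~ odd x by lia.
  have sE : (x + y = 2 * ((x + y) %/ 2))%N by lia.
  have dE : (x = y + 2 * (`|x - y| %/ 2))%N by lia.
  set s := ((x + y) %/ 2)%N in sE *; set d := (`|x - y| %/ 2)%N in dE *.
  have ps : prime s.
    apply: (@sieve_primality x); [lia|lia|lia|] => p hp hps.
    have /andP[/negP[]] := noF p hp.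
    rewrite mem_Fplus yS -/x -opprD -PoszD dvdzE abszN sE /=.
    exact: dvdn_mull.
  have pd : prime d || (d == 1)%N.
    have [d1|d1] := eqVneq d 1%N; rewrite ?orbT ?orbF //.
    apply: (@sieve_primality x); [lia|lia|lia|] => p hp hpd.
    have /andP[_] := noF p hp.
    rewrite mem_Fminus yS -/x {1}dE (_ : _ - _ = 2 * d%:Z); last by lia.
    by rewrite dvdz_mull //= negbK dE => /eqP; lia.
  have d2 : prime d -> (2 < d)%N by move/prime_gt1; lia.
  rewrite ps.
  apply/and5P; split; try lia.
Qed.

Theorem theorem4p2 (n k : nat) (hn : (0 < n)%N) (hk : k = 0%N \/ k = 6%N) :
  let x := (12 * n + k)%N in
  let n1 := if k == 0%N then n else n.+1 in
  let b1 : int := if k == 0%N then 2 else 4 in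
  let b2 : int := if k == 0%N then 10 else 8 in
  (degree (near_goldbach (x %/ 2)%N) x)%:Z
    = n%:Z + n1%:Z - (sieve_count n k)%:Z
  /\
  forall p : nat, sieve_prime x p ->
    let k1 := res0 p ((p%:Z - res1 p x%:Z - b1) * 12 ^+ (p - 2)%N) + 1 in
    let k2 := res0 p ((x%:Z - b1) * 12 ^+ (p - 2)%N) + 1 in
    let k3 := res0 p ((p%:Z - res1 p x%:Z - b2) * 12 ^+ (p - 2)%N) + 1 in
    let k4 := res0 p ((x%:Z - b2) * 12 ^+ (p - 2)%N) + 1 in
    #|` (Fplus n k p `|` Fminus n k p)%fset |%:Z =
      if (p %| x)%N then
        ((n1%:Z - k1) %/ p%:Z)%Z + ((n%:Z - k3) %/ p%:Z)%Z + 2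
      else
        ((n1%:Z - k1) %/ p%:Z)%Z + ((n1%:Z - k2) %/ p%:Z)%Z
        + ((n%:Z - k3) %/ p%:Z)%Z + ((n%:Z - k4) %/ p%:Z)%Z + 3.
Proof.
move=> x n1 b1 b2; split=> [|p hp k1 k2 k3 k4].
  rewrite /degree /sieve_count -/x.
  set U := (\bigcup_(p <- _ | _) _)%fset.
  have US : (U `<=` Sset n k)%fset.
    apply/bigfcupsP => p _ _; apply/fsubsetP => y.
    by rewrite in_fsetU mem_Fplus mem_Fminus => /orP[/andP[]|/and3P[]].
  have -> : [fset b in vert (near_goldbach (x %/ 2))
             | adj (near_goldbach (x %/ 2)) x b]%fset = (Sset n k `\` U)%fset.
    apply/fsetP => y; rewrite in_fsetD andbC -ngg_adj_sieve // !inE /=.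
    by apply: andb_idl => /ngg_adj_vert/andP[].
  have := fsubset_leq_card US; rewrite cardfsDS // card_Sset -/n1; lia.
move: (hp); rewrite sieve_primeE => /and3P[pp p3 _].
rewrite card_FplusUminus // (card_class n pp p3 (res1_mod _ _ _) (res1_mod _ _ _)).
rewrite (card_class (a1 := x%:Z - b1) (a2 := x%:Z - b2) n pp p3 erefl erefl) -/x -/n1 -/b1 -/b2.
by case: ifP => _; rewrite -/k1 -/k2 -/k3 -/k4 //; ring.
Qed.
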